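(* Suppose $R=3$. Then any line in $\mathrm{P}C$ is the projectivization of some 2-dimensional null subalgebra of the split octonions $\mathbb{O}'$, and conversely, the projectivization of any 2-dimensional null subalgebra of $\mathbb{O}'$ gives a line in $\mathrm{P}C$.
   Context: $\mathbb{H}$ denotes the quaternions with conjugation $x\mapsto\overline{x}$ and norm $|x|^2=x\overline{x}$; $\mathrm{Im}(\mathbb{H})=\{x\in\mathbb{H}:\overline{x}=-x\}$ is identified with $\mathbb{R}^3$. $S^2$ is the set of unit vectors in $\mathrm{Im}(\mathbb{H})\cong\mathbb{R}^3$, and $\mathrm{SU}(2)$ is identified with the group of unit quaternions. The double cover $\mathrm{SU}(2)\to\mathrm{SO}(3)$ sends $q$ to the rotation $x\mapsto qxq^{-1}$ of $\mathrm{Im}(\mathbb{H})$. The split octonions $\mathbb{O}'$ are the real vector space $\mathbb{H}\oplus\mathbb{H}$ with product $(a,b)(c,d)=(ac+d\overline{b},\,\overline{a}d+cb)$, conjugation $\overline{(a,b)}=(\overline{a},-b)$ and quadratic form $Q(a,b)=|a|^2-|b|^2$. The imaginary split octonions are $\mathbb{I}=\{x\in\mathbb{O}':\overline{x}=-x\}=\mathrm{Im}(\mathbb{H})\oplus\mathbb{H}$. Let $C=\{x\in\mathbb{I}:Q(x)=0\}$ and $\mathrm{P}C=\{x\in C:x\neq0\}/\mathbb{R}^*$. A point of $\mathrm{P}C$ is written $\pm(v,q)$, the class of a vector $(v,q)$ with $|v|=|q|=1$. A null subalgebra of $\mathbb{O}'$ is a linear subspace $V\subset\mathbb{O}'$ with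 $xy=0$ for all $x,y\in V$; any such $V$ is contained in $C\subset\mathbb{I}$, so its projectivization $\mathrm{P}V=\{x\in V:x\neq0\}/\mathbb{R}^*$ is a subset of $\mathrm{P}C$. Lines (these depend on the radius $R$ of a fixed ball on which a ball of radius $1$ rolls): - A line in $S^2\times\mathrm{SO}(3)$ is any subset of the form $\{(\cos(\Phi)u+\sin(\Phi)v,\ \mathbf{R}(u\times v,(1+R)\Phi)\,g):\Phi\in\mathbb{R}\}$ with $u,v\in\mathbb{R}^3$ orthogonal unit vectors and $g\in\mathrm{SO}(3)$, where $\mathbf{R}(w,\alpha)$ is the right-handed rotation by angle $\alpha$ about the unit vector $w$. - A line in $S^2\times\mathrm{SU}(2)$ is the inverse image of a line in $S^2\times\mathrm{SO}(3)$ under the covering map $S^2\times\mathrm{SU}(2)\to S^2\times\mathrm{SO}(3)$. - A line in $\mathbb{R}\mathrm{P}^2\times\mathrm{SU}(2)$ is the image of a line in $S^2\times\mathrm{SU}(2)$ under the double cover $(v,q)\mapsto(\pm v,q)$. - A line in $\mathrm{P}C$ is the image of a line in $\mathbb{R}\mathrm{P}^2\times\mathrm{SU}(2)$ under the diffeomorphism $\tau\colon\mathbb{R}\mathrm{P}^2\times\mathrm{SU}(2)\to\mathrm{P}C$, $(\pm v,q)\mapsto\pm(v,vq)$.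
   Formalization: A line in S²×SU(2) is taken to be a connected component of the inverse image of a line in S²×SO(3), not the whole inverse image: for R=3 that is two disjoint circles, whose image in PC contains the classes of (u,uq) and (u,-uq), which lie in no common null subalgebra. *)

(* Defs.v *)
From HB Require Import structures.
From mathcomp Require Import all_boot all_order all_algebra.
From mathcomp Require Import all_classical all_reals all_analysis.
From mathcomp Require Import ring lra.

Set Implicit Arguments.
Unset Strict Implicit.
Unset Printing Implicit Defensive.

Import Order.TTheory GRing.Theory Num.Theory.
Import numFieldNormedType.Exports.

Local Open Scope classical_set_scope.
Local Open Scope ring_scope.

(* Abbreviations rather than constants, so that the vector space and
   topological structures of products are found by unification. *)
Notation vec3 R := 'cV[R]_3.
(* A quaternion is a pair (real part, imaginary part). *)
Notation quat R := (R^o * 'cV[R]_3)%type.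
Notation octo R := (quat R * quat R)%type.

Section Vectors.
Context {R : realType}.
Implicit Types (u v w x : vec3 R) (a : R).

Definition dot3 u v : R := \sum_(i < 3) u i 0 * v i 0.

(* Indices are added in 'I_3 = Z/3. *)
Definition cross3 u v : vec3 R :=
  \col_i (u (i + 1) 0 * v (i + 2) 0 - u (i + 2) 0 * v (i + 1) 0).

Definition S2 : set (vec3 R) := [set v | dot3 v v = 1].

(* Matrices act on column vectors from the left. *)
Definition mx_of (f : vec3 R -> vec3 R) : 'M[R]_3 :=
  \matrix_(i, j) f (delta_mx j 0) i 0.

Definition SO3 : set 'M[R]_3 := [set g | g *m g^T = 1%:M /\ \det g = 1].

(* Rodrigues' formula: the right-handed rotation by the angle a about the unit
   vector w. *)
Definition rotation w a : 'M[R]_3 :=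
  mx_of (fun x =>
    cos a *: x + sin a *: cross3 w x + ((1 - cos a) * dot3 w x) *: w).

End Vectors.

Section Quaternions.
Context {R : realType}.
Implicit Types (p q : quat R) (v : vec3 R).

Definition qmul p q : quat R :=
  (p.1 * q.1 - dot3 p.2 q.2, p.1 *: q.2 + q.1 *: p.2 + cross3 p.2 q.2).

Definition qconj q : quat R := (q.1, - q.2).

(* |q|^2 = q * conj q, whose imaginary part vanishes. *)
Definition qnorm2 q : R := (qmul q (qconj q)).1.

Definition qinv q : quat R := (qnorm2 q)^-1 *: qconj q.

(* The identification of R^3 with Im(H). *)
Definition imq v : quat R := (0, v).

Definition SU2 : set (quat R) := [set q | qnorm2 q = 1].

Definition su2_so3 q : 'M[R]_3 :=
  mx_of (fun x => (qmul (qmul q (imq x)) (qinv q)).2).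

End Quaternions.

Section SplitOctonions.
Context {R : realType}.
Implicit Types (x y : octo R) (V : {vspace octo R}).

Definition omul x y : octo R :=
  (qmul x.1 y.1 + qmul y.2 (qconj x.2), qmul (qconj x.1) y.2 + qmul y.1 x.2).

Definition oconj x : octo R := (qconj x.1, - x.2).

Definition Qform x : R := qnorm2 x.1 - qnorm2 x.2.

Definition ImO : set (octo R) := [set x | oconj x = - x].

Definition nullcone : set (octo R) := [set x | ImO x /\ Qform x = 0].

Definition null_subalgebra V : Prop :=
  forall x y, x \in V -> y \in V -> omul x y = 0.

(* The class of x modulo R^*, for x != 0. *)
Definition pclass x : set (octo R) := [set y | exists2 t : R, t != 0 & y = t *: x].

Definition PC : set (set (octo R)) :=
  pclass @` [set x | nullcone x /\ x != 0].

Definition projectivization V : set (set (octo R)) :=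
  pclass @` [set x | x \in V /\ x != 0].

End SplitOctonions.

Section Lines.
Context {R : realType}.

Definition line_S2_SO3 (r : R) (L : set (vec3 R * 'M[R]_3)) : Prop :=
  exists u v : vec3 R, exists g : 'M[R]_3,
    [/\ S2 u, S2 v, dot3 u v = 0, SO3 g &
        L = range (fun phi : R =>
              (cos phi *: u + sin phi *: v,
               rotation (cross3 u v) ((1 + r) * phi) *m g))].

Definition preimage_SU2 (L : set (vec3 R * 'M[R]_3)) : set (vec3 R * quat R) :=
  [set x | [/\ S2 x.1, SU2 x.2 & L (x.1, su2_so3 x.2)]].

(* The inverse image of a line under the double cover can be disconnected: for
   r = 3 it is the disjoint union of the two closed curves
     phi |-> (cos phi u + sin phi v, exp (2 phi (u x v)) q),
   with q one of the two quaternions that cover g. A line is one connected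
   component of the inverse image. The whole inverse image would not do: in
   projective space it contains the classes of both (u, u q) and (u, - u q),
   and no linear subspace of the null cone contains these two vectors. *)
Definition line_S2_SU2 (r : R) (L : set (vec3 R * quat R)) : Prop :=
  exists L0 x, [/\ line_S2_SO3 r L0, preimage_SU2 L0 x &
                   L = connected_component (preimage_SU2 L0) x].

(* Points of RP^2 are the sets {v, -v} with v in S^2. *)
Definition pm (v : vec3 R) : set (vec3 R) := [set v; - v].

Definition line_RP2_SU2 (r : R) (L : set (set (vec3 R) * quat R)) : Prop :=
  exists2 L0, line_S2_SU2 r L0 & L = (fun x => (pm x.1, x.2)) @` L0.

(* The union of the classes of (v, v q) for v in l; these coincide when
   l = {v, -v}, see tauE. *)
Definition tau (x : set (vec3 R) * quat R) : set (octo R) :=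
  \bigcup_(v in x.1) pclass (imq v, qmul (imq v) x.2).

Definition line_PC (r : R) (L : set (set (octo R))) : Prop :=
  exists2 L0, line_RP2_SU2 r L0 & L = tau @` L0.

Lemma tauE (v : vec3 R) (q : quat R) :
  tau (pm v, q) = pclass (imq v, qmul (imq v) q).
Proof.
have dotN (a b : vec3 R) : dot3 (- a) b = - dot3 a b.
  by rewrite /dot3 -sumrN; apply: eq_bigr => i _; rewrite mxE mulNr.
have crossN (a b : vec3 R) : cross3 (- a) b = - cross3 a b.
  by apply/colP => i; rewrite !mxE !mulNr opprB opprK addrC.
have pclassN (x : octo R) : pclass (- x) = pclass x.
  apply/seteqP; split => y [t t0 ->]; exists (- t); rewrite ?oppr_eq0 //.
    by rewrite scalerN scaleNr.
  by rewrite scaleNr scalerN opprK.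
have E : (imq (- v), qmul (imq (- v)) q) = - (imq v, qmul (imq v) q) :> octo R.
  rewrite /imq /qmul /= dotN crossN !mul0r !scale0r !sub0r !add0r scalerN.
  by congr ((_, _), (_, _)); rewrite ?oppr0 ?opprD.
rewrite /tau /pm bigcup_setU !bigcup_set1 /= E pclassN.
exact: setUid.
Qed.

Lemma tau_PC (v : vec3 R) (q : quat R) : S2 v -> SU2 q -> PC (tau (pm v, q)).
Proof.
rewrite /S2 /SU2 /= => v1 q1; rewrite tauE; exists (imq v, qmul (imq v) q) => //.
have dot0l (b : vec3 R) : dot3 0 b = 0.
  by rewrite /dot3 big1 // => i _; rewrite mxE mul0r.
split.
  split.
    by rewrite /ImO /oconj /qconj /imq /=; congr ((_, _), _); rewrite oppr0.
  rewrite /Qform; apply/eqP; rewrite subr_eq0; apply/eqP.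
  have -> : qnorm2 (imq v) = dot3 v v * qnorm2 q.
    rewrite q1 mulr1 /qnorm2 /qmul /= mul0r sub0r /dot3 -sumrN.
    by apply: eq_bigr => i _; rewrite !mxE mulrN opprK.
  rewrite /qnorm2 /qmul /qconj /imq /= /dot3 !big_ord_recl !big_ord0 !mxE /=.
  set i0 : 'I_3 := ord0; set i1 : 'I_3 := lift ord0 ord0.
  set i2 : 'I_3 := lift ord0 (lift ord0 ord0).
  have e01 : i0 + 1 = i1 by exact: val_inj.
  have e02 : i0 + 2 = i2 by exact: val_inj.
  have e11 : i1 + 1 = i2 by exact: val_inj.
  have e12 : i1 + 2 = i0 by exact: val_inj.
  have e21 : i2 + 1 = i0 by exact: val_inj.
  have e22 : i2 + 2 = i1 by exact: val_inj.
  by rewrite !(e01, e02, e11, e12, e21, e22); ring.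
apply/eqP => -[v0 _ _]; move: v1; rewrite v0 dot0l => /esym/eqP.
by rewrite oner_eq0.
Qed.

End Lines.

(* Main.v *)
Require Import Defs.
From mathcomp Require Import all_boot all_order all_algebra.
From mathcomp Require Import all_classical all_reals all_analysis.
From mathcomp Require Import ring lra.

(** For orthonormal vectors [u], [v] of R^3 and a unit quaternion [q], let
    [nullplane u v q] be the span of [(u, u q)] and [(v, - v q)]. Both halves of
    the theorem follow from the fact that these planes are at once the
    2-dimensional null subalgebras and, for radius 3, the lines.

    Lines are such planes ([line_PCP]). Put [w = u x v], write e^(t w) for
    cos t + sin t w, and let [y = cos phi u + sin phi v]. Left multiplication
    by w turns the plane of u, v, so u e^(- phi w) = y. For radius 3 the ball
    turns by the angle 4 phi; its lift to the unit quaternions turns by 2 phi,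
    so that a lifted line runs through the points (y, e^(2 phi w) q). The map
    tau sends such a point to the class of (y, y e^(2 phi w) q), and
      y e^(2 phi w) = u e^(- phi w) e^(2 phi w) = u e^(phi w)
                    = cos phi u - sin phi v.
    Hence the point goes to the class of
    cos phi (u, u q) + sin phi (v, - v q), and these classes exhaust the
    projectivized plane ([tau_rolling]). Only for radius 3 do the angles match.

    That a lifted line has the form above ([line_S2_SU2P]) needs the kernel of
    SU(2) -> SO(3), which is {1, -1}, and a separation argument: the inverse
    image of a line consists of the curves through q and through - q, and a
    polynomial function equal to 1 on the former and to -1 on the latter
    ([sheet]) shows that they are different components.

    Null subalgebras are such planes ([null_is_nullplane]). If x x = 0 then
    x = (a, b) with a imaginary and |a| = |b| ([null_square]); hence a null
    subalgebra projects injectively to R^3, and a 2-dimensional one has a basis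
    (u, b), (v, d) with u, v orthonormal and b a unit. Then b = u q for a unit
    quaternion q, and (u, b) (v, d) = 0 forces d = - v q ([null_spokes]). *)

Set Implicit Arguments.
Unset Strict Implicit.
Unset Printing Implicit Defensive.

Import Order.TTheory GRing.Theory Num.Theory.
Import numFieldNormedType.Exports.

Local Open Scope classical_set_scope.
Local Open Scope ring_scope.

(** * Coordinates *)

Section Coordinates.
Context {R : realType}.
Implicit Types (u v : vec3 R) (p q : quat R).

Lemma vec3_eq u v :
  u 0 0 = v 0 0 -> u 1 0 = v 1 0 -> u 2 0 = v 2 0 -> u = v.
Proof.
move=> e0 e1 e2; apply/colP => i.
have : (i == 0) || (i == 1) || (i == 2) by case: i => [[|[|[|]]]].
by case/orP => [/orP[]|] /eqP ->.
Qed.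

Lemma quat_eq p q : p.1 = q.1 :> R ->
  p.2 0 0 = q.2 0 0 -> p.2 1 0 = q.2 1 0 -> p.2 2 0 = q.2 2 0 -> p = q.
Proof.
by case: p q => [a x] [b y] /= -> e0 e1 e2; congr pair; exact: vec3_eq.
Qed.

Lemma dot3E u v : dot3 u v = u 0 0 * v 0 0 + u 1 0 * v 1 0 + u 2 0 * v 2 0.
Proof.
rewrite /dot3 !big_ord_recl big_ord0 addr0 addrA.
by congr (_ * _ + _ * _ + _ * _); congr (fun_of_matrix _ _ _); exact: val_inj.
Qed.

Lemma cross3E u v :
  (cross3 u v 0 0 = u 1 0 * v 2 0 - u 2 0 * v 1 0) *
  (cross3 u v 1 0 = u 2 0 * v 0 0 - u 0 0 * v 2 0) *
  (cross3 u v 2 0 = u 0 0 * v 1 0 - u 1 0 * v 0 0).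
Proof.
by do ?split; rewrite mxE; congr (_ * _ - _ * _);
  congr (fun_of_matrix _ _ _); exact: val_inj.
Qed.

Lemma mulmx3E (M : 'M[R]_3) u i :
  (M *m u) i 0 = M i 0 * u 0 0 + M i 1 * u 1 0 + M i 2 * u 2 0.
Proof.
rewrite mxE !big_ord_recl big_ord0 addr0 addrA.
by congr (_ * _ + _ * _ + _ * _); congr (fun_of_matrix _ _ _); exact: val_inj.
Qed.

Lemma det3E (M : 'M[R]_3) : \det M =
  M 0 0 * (M 1 1 * M 2 2 - M 1 2 * M 2 1)
  - M 0 1 * (M 1 0 * M 2 2 - M 1 2 * M 2 0)
  + M 0 2 * (M 1 0 * M 2 1 - M 1 1 * M 2 0).
Proof.
have e1 : lift 0 0 = 1 :> 'I_3 by exact: val_inj.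
have e2 : lift 0 1 = 2 :> 'I_3 by exact: val_inj.
have e3 : lift 1 0 = 0 :> 'I_3 by exact: val_inj.
have e4 : lift 1 1 = 2 :> 'I_3 by exact: val_inj.
have e5 : lift 2 0 = 0 :> 'I_3 by exact: val_inj.
have e6 : lift 2 1 = 1 :> 'I_3 by exact: val_inj.
have f1 : lift 0 0 = 1 :> 'I_2 by exact: val_inj.
have f2 : lift 1 0 = 0 :> 'I_2 by exact: val_inj.
rewrite (expand_det_row _ 0) !big_ord_recl big_ord0 /cofactor.
rewrite !(expand_det_row _ (0 : 'I_2)) !big_ord_recl !big_ord0 /cofactor.
rewrite !det_mx11 !mxE !(e1, e2, e3, e4, e5, e6, f1, f2).
rewrite -[ord0]/(0 : 'I_3) -[ord0]/(0 : 'I_2) /= /bump /=.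
by rewrite !addn0 !expr0 expr1 expr2; ring.
Qed.

Lemma mx_eq (M N : 'M[R]_3) : (forall u, M *m u = N *m u) -> M = N.
Proof.
move=> MN; apply/matrixP => i j.
have /colP/(_ i) := MN (delta_mx j 0).
by rewrite -!colE !mxE.
Qed.

Lemma mx_ofE (f : vec3 R -> vec3 R) u :
  (forall a x y, f (a *: x + y) = a *: f x + f y) -> mx_of f *m u = f u.
Proof.
move=> lf.
have f0 : f 0 = 0.
  by have := lf (-1) 0 0; rewrite scaler0 addr0 scaleN1r addNr.
have {2}-> : u = u 0 0 *: delta_mx 0 0 +
    (u 1 0 *: delta_mx 1 0 + (u 2 0 *: delta_mx 2 0 + 0)).
  by apply: vec3_eq; rewrite !mxE /=; ring.
by rewrite !lf f0; apply/colP => i; rewrite mulmx3E !mxE; ring.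
Qed.

End Coordinates.

Definition coordE := (@dot3E, @cross3E, @mxE).

(* A scaling of the real part is a scaling in R^o, which has to be unfolded to a
   product before it is visible as one in R. *)
Ltac coord_ring := rewrite /= ?coordE /= ?coordE /GRing.scale /=; ring.
Ltac vec3_ring := apply: vec3_eq; coord_ring.
Ltac quat_ring := apply: quat_eq; coord_ring.

(** * Quaternions *)

Section QuaternionAlgebra.
Context {R : realType}.
Implicit Types (u v : vec3 R) (p q : quat R) (t : R).

Lemma qmulA p q k : qmul p (qmul q k) = qmul (qmul p q) k.
Proof. by quat_ring. Qed.

Lemma qmulDl p q k : qmul (p + q) k = qmul p k + qmul q k.
Proof. by quat_ring. Qed.

Lemma qmulDr p q k : qmul p (q + k) = qmul p q + qmul p k.
Proof. by quat_ring. Qed.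

Lemma qmulZl t p q : qmul (t *: p) q = t *: qmul p q.
Proof. by quat_ring. Qed.

Lemma qmulZr t p q : qmul p (t *: q) = t *: qmul p q.
Proof. by quat_ring. Qed.

Lemma qmulNq p q : qmul (- p) q = - qmul p q.
Proof. by quat_ring. Qed.

Lemma qmulqN p q : qmul p (- q) = - qmul p q.
Proof. by quat_ring. Qed.

Lemma qmul0q q : qmul 0 q = 0.
Proof. by quat_ring. Qed.

Lemma qmul1q q : qmul (1, 0) q = q.
Proof. by quat_ring. Qed.

Lemma qmulq1 q : qmul q (1, 0) = q.
Proof. by quat_ring. Qed.

Lemma qconjK : involutive (@qconj R).
Proof. by case=> a u; rewrite /qconj opprK. Qed.

Lemma qconjD p q : qconj (p + q) = qconj p + qconj q.
Proof. by quat_ring. Qed.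

Lemma qconjZ t q : qconj (t *: q) = t *: qconj q.
Proof. by quat_ring. Qed.

Lemma qconjM p q : qconj (qmul p q) = qmul (qconj q) (qconj p).
Proof. by quat_ring. Qed.

Lemma qconj_imq u : qconj (imq u) = - imq u.
Proof. by quat_ring. Qed.

Lemma imq_inj : injective (@imq R).
Proof. by move=> u v []. Qed.

Lemma imq_anticomm u v : dot3 u v = 0 ->
  qmul (imq u) (imq v) + qmul (imq v) (imq u) = 0.
Proof.
move=> uv; transitivity ((- dot3 u v *+ 2, 0) : quat R).
  by quat_ring.
by rewrite uv oppr0 mul0rn.
Qed.

Lemma dot3_ge0 u : 0 <= dot3 u u.
Proof. by rewrite dot3E -!expr2 !addr_ge0 ?sqr_ge0. Qed.

Lemma dot3_eq0 u : dot3 u u = 0 -> u = 0.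
Proof.
move=> /eqP; rewrite /dot3 psumr_eq0; last by move=> i _; rewrite -expr2 sqr_ge0.
move/allP => u0; apply/colP => i; rewrite mxE; apply/eqP.
by have := u0 i (mem_index_enum _); rewrite mulf_eq0 orbb.
Qed.

Lemma S2_neq0 u : S2 u -> u != 0.
Proof.
move=> u1; apply/eqP => u0; move: u1; rewrite /S2 /= u0 !coordE !mulr0 !addr0.
by move/esym/eqP; rewrite oner_eq0.
Qed.

Lemma qnorm2E q : qnorm2 q = q.1 ^+ 2 + dot3 q.2 q.2.
Proof. by rewrite /qnorm2; coord_ring. Qed.

Lemma qnorm2M p q : qnorm2 (qmul p q) = qnorm2 p * qnorm2 q.
Proof. by rewrite /qnorm2; coord_ring. Qed.

Lemma SU2_1 : SU2 ((1, 0) : quat R).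
Proof. by rewrite /SU2 /qnorm2; coord_ring. Qed.

Lemma SU2M p q : SU2 p -> SU2 q -> SU2 (qmul p q).
Proof. by rewrite /SU2 /= qnorm2M => -> ->; rewrite mulr1. Qed.

Lemma SU2N q : SU2 q -> SU2 (- q).
Proof. by rewrite /SU2 /= => <-; rewrite /qnorm2; coord_ring. Qed.

Lemma SU2_qconj q : SU2 q -> SU2 (qconj q).
Proof. by rewrite /SU2 /= => <-; rewrite /qnorm2; coord_ring. Qed.

Lemma SU2_imq u : S2 u -> SU2 (imq u).
Proof. by rewrite /S2 /SU2 /= qnorm2E expr0n add0r. Qed.

Lemma qmul_qconj q : SU2 q -> qmul q (qconj q) = (1, 0).
Proof. by move=> q1; apply: quat_eq; [exact: q1|..]; coord_ring. Qed.

Lemma qconj_qmul q : SU2 q -> qmul (qconj q) q = (1, 0).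
Proof. by move=> /SU2_qconj/qmul_qconj; rewrite qconjK. Qed.

Lemma qinv_unit q : SU2 q -> qinv q = qconj q.
Proof. by move=> q1; rewrite /qinv q1 invr1 scale1r. Qed.

End QuaternionAlgebra.

(** * The double cover of the rotation group *)

Section DoubleCover.
Context {R : realType}.
Implicit Types (w x : vec3 R) (p q : quat R) (c s a : R).

Lemma su2_so3E q x : SU2 q ->
  imq (su2_so3 q *m x) = qmul (qmul q (imq x)) (qconj q).
Proof.
move=> q1; rewrite mx_ofE qinv_unit //; first by quat_ring.
by move=> a y z; vec3_ring.
Qed.

Lemma su2_so3M p q : SU2 p -> SU2 q ->
  su2_so3 (qmul p q) = su2_so3 p *m su2_so3 q.
Proof.
move=> p1 q1; apply: mx_eq => x; apply: imq_inj.
rewrite -mulmxA !su2_so3E //; last exact: SU2M.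
by rewrite qconjM !qmulA.
Qed.

Lemma su2_so3N q : SU2 q -> su2_so3 (- q) = su2_so3 q.
Proof.
move=> q1; apply: mx_eq => x; apply: imq_inj.
by rewrite !su2_so3E //; [quat_ring|exact: SU2N].
Qed.

Lemma su2_so3_1 : su2_so3 (1, 0) = 1%:M :> 'M[R]_3.
Proof.
apply: mx_eq => x; apply: imq_inj; rewrite su2_so3E; last exact: SU2_1.
by rewrite qmul1q mul1mx; quat_ring.
Qed.

Lemma su2_so3_entries q : SU2 q ->
  let M := su2_so3 q in let a := q.1 : R in
  let x := q.2 0 0 in let y := q.2 1 0 in let z := q.2 2 0 in
  ((M 0 0 = a ^+ 2 + x ^+ 2 - y ^+ 2 - z ^+ 2) *
   (M 0 1 = 2 * (x * y - a * z)) *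
   (M 0 2 = 2 * (x * z + a * y))) *
  ((M 1 0 = 2 * (x * y + a * z)) *
   (M 1 1 = a ^+ 2 - x ^+ 2 + y ^+ 2 - z ^+ 2) *
   (M 1 2 = 2 * (y * z - a * x))) *
  ((M 2 0 = 2 * (x * z - a * y)) *
   (M 2 1 = 2 * (y * z + a * x)) *
   (M 2 2 = a ^+ 2 - x ^+ 2 - y ^+ 2 + z ^+ 2)).
Proof.
by move=> q1 /=; do !split; rewrite mxE qinv_unit //; coord_ring.
Qed.

(** Orthogonality holds because the transpose belongs to the conjugate
    quaternion; the determinant is the cube of the norm. *)
Lemma su2_so3_SO3 q : SU2 q -> SO3 (su2_so3 q).
Proof.
move=> q1; have q'1 := SU2_qconj q1; split.
  have trE (M : 'M[R]_3) i j : M^T i j = M j i by rewrite mxE.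
  have -> : (su2_so3 q)^T = su2_so3 (qconj q).
    apply: mx_eq => x.
    by apply: vec3_eq; rewrite !mulmx3E !trE !su2_so3_entries //= ?mxE; ring.
  by rewrite -su2_so3M // qmul_qconj // su2_so3_1.
rewrite -[RHS](expr1n _ 3) -[in RHS]q1 /qnorm2 det3E !su2_so3_entries //.
by coord_ring.
Qed.

(** The diagonal entries of the identity matrix make the sum of the squares of
    any two imaginary coordinates vanish. *)
Lemma su2_so3_eq1 q : SU2 q -> su2_so3 q = 1%:M -> q = (1, 0) \/ q = - (1, 0).
Proof.
move=> q1 E; have := su2_so3_entries q1; rewrite /= E !mxE /=.
case=> [[[[h0 _] _] [[_ h1] _]] [_ h2]].
move: q1; rewrite /SU2 /qnorm2 /= !coordE.
case: q h0 h1 h2 {E} => a b /= h0 h1 h2 n1.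
have sq0 (t : R) : t * t = 0 -> t = 0 by move/eqP; rewrite mulf_eq0 orbb => /eqP.
have b0 : b 0 0 = 0 by apply: sq0; lra.
have b1 : b 1 0 = 0 by apply: sq0; lra.
have b2 : b 2 0 = 0 by apply: sq0; lra.
have -> : b = 0 by apply: vec3_eq; rewrite mxE.
move: n1; rewrite b0 b1 b2 => n1.
have : (a - 1) * (a + 1) = 0 :> R by lra.
move/eqP; rewrite mulf_eq0 subr_eq0 addr_eq0 => /orP[] /eqP ->; first by left.
by right; quat_ring.
Qed.

Lemma su2_so3_fibre p q : SU2 p -> SU2 q -> su2_so3 p = su2_so3 q ->
  p = q \/ p = - q.
Proof.
move=> p1 q1 E; have q'1 := SU2_qconj q1.
have : su2_so3 (qmul p (qconj q)) = 1%:M.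
  by rewrite su2_so3M // E -su2_so3M // qmul_qconj // su2_so3_1.
have Ep : p = qmul (qmul p (qconj q)) q by rewrite -qmulA qconj_qmul // qmulq1.
move/su2_so3_eq1 => -[|E1|E1]; first exact: SU2M.
  by left; rewrite Ep E1 qmul1q.
by right; rewrite Ep E1 qmulNq qmul1q.
Qed.

(** The exponential of the imaginary quaternion [a *: w], for a unit vector. *)
Definition qexp w a : quat R := (cos a, sin a *: w).

Lemma SU2_qexp w a : S2 w -> SU2 (qexp w a).
Proof.
rewrite /S2 /SU2 /= => w1.
rewrite -(cos2Dsin2 a) -[sin a ^+ 2]mulr1 -w1 /qnorm2.
by rewrite /= !coordE /=; ring.
Qed.

Lemma rotationE w a x : rotation w a *m x =
  cos a *: x + sin a *: cross3 w x + ((1 - cos a) * dot3 w x) *: w.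
Proof. by rewrite mx_ofE // => b y z; vec3_ring. Qed.

Lemma qmul_conjugation c s w x : dot3 w w = 1 -> c ^+ 2 + s ^+ 2 = 1 ->
  qmul (qmul (c, s *: w) (imq x)) (qconj (c, s *: w)) =
  imq ((c ^+ 2 - s ^+ 2) *: x + (c * s *+ 2) *: cross3 w x
       + ((1 - (c ^+ 2 - s ^+ 2)) * dot3 w x) *: w).
Proof.
(* The factors 1 are replaced so that both sides become the same polynomial. *)
move=> w1 cs.
have -> : c ^+ 2 - s ^+ 2 = c ^+ 2 - s ^+ 2 * dot3 w w by rewrite w1 mulr1.
have -> : 1 - (c ^+ 2 - s ^+ 2 * dot3 w w) = s ^+ 2 *+ 2.
  by rewrite w1 mulr1 -cs; ring.
by clear; quat_ring.
Qed.

(** Conjugation by a unit quaternion turns by twice its angle. *)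
Lemma su2_so3_qexp w a : S2 w -> su2_so3 (qexp w a) = rotation w (a *+ 2).
Proof.
move=> w1; apply: mx_eq => x; apply: imq_inj.
rewrite su2_so3E; last exact: SU2_qexp.
rewrite qmul_conjugation //; last exact: cos2Dsin2.
rewrite rotationE cos_mulr2n sin_mulr2n.
have -> // : cos a ^+ 2 *+ 2 - 1 = cos a ^+ 2 - sin a ^+ 2.
by rewrite -(cos2Dsin2 a); ring.
Qed.

End DoubleCover.

(** * Lines upstairs: components of the inverse image *)

Section LiftedLines.
Context {R : realType}.
Implicit Types (u v w x : vec3 R) (p q : quat R) (c s phi : R).

Definition orthonormal2 u v := [/\ S2 u, S2 v & dot3 u v = 0].

Definition rolling_SO3 u v (g : 'M[R]_3) phi : vec3 R * 'M[R]_3 :=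
  (cos phi *: u + sin phi *: v, rotation (cross3 u v) ((1 + 3) * phi) *m g).

(** The lift of [rolling_SO3] to the unit quaternions: the angle 4 phi is halved
    by the double cover. *)
Definition rolling u v q phi : vec3 R * quat R :=
  (cos phi *: u + sin phi *: v, qmul (qexp (cross3 u v) (phi *+ 2)) q).

Lemma S2_cross u v : orthonormal2 u v -> S2 (cross3 u v).
Proof.
move=> [u1 v1 uv]; rewrite /S2 /=.
transitivity (dot3 u u * dot3 v v - dot3 u v ^+ 2); first by coord_ring.
by rewrite u1 v1 uv; ring.
Qed.

Lemma S2_circle u v c s : orthonormal2 u v -> c ^+ 2 + s ^+ 2 = 1 ->
  S2 (c *: u + s *: v).
Proof.
move=> [u1 v1 uv] cs; rewrite /S2 /= -cs.
transitivity (c ^+ 2 * dot3 u u + s ^+ 2 * dot3 v v + 2 * c * s * dot3 u v).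
  by coord_ring.
by rewrite u1 v1 uv; ring.
Qed.

Lemma S2_rolling u v q phi : orthonormal2 u v -> S2 (rolling u v q phi).1.
Proof. by move=> h; apply: S2_circle => //; exact: cos2Dsin2. Qed.

Lemma SU2_rolling u v q phi : orthonormal2 u v -> SU2 q ->
  SU2 (rolling u v q phi).2.
Proof. by move=> h q1; apply: SU2M => //; apply/SU2_qexp/S2_cross. Qed.

Lemma su2_so3_rolling u v q phi : orthonormal2 u v -> SU2 q ->
  su2_so3 (rolling u v q phi).2 =
  rotation (cross3 u v) ((1 + 3) * phi) *m su2_so3 q.
Proof.
move=> h q1; have w1 := S2_cross h.
rewrite su2_so3M // ?su2_so3_qexp //; last exact: SU2_qexp.
by congr (rotation _ _ *m _); ring.
Qed.

Lemma preimage_rolling u v q : orthonormal2 u v -> SU2 q ->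
  preimage_SU2 (range (rolling_SO3 u v (su2_so3 q))) =
  range (rolling u v q) `|` range (rolling u v (- q)).
Proof.
move=> h q1.
have lift_sub q' : SU2 q' -> range (rolling u v q') `<=`
    preimage_SU2 (range (rolling_SO3 u v (su2_so3 q'))).
  move=> q'1 _ [phi _ <-].
  split; [exact: S2_rolling|exact: SU2_rolling|exists phi => //].
  by rewrite su2_so3_rolling.
apply/seteqP; split => [[y p]|]; last first.
  rewrite subUset; split; first exact: lift_sub.
  by rewrite -su2_so3N //; apply/lift_sub/SU2N.
move=> [/= y1 p1 [phi _ [ye pe]]].
have [pq|pq] : p = (rolling u v q phi).2 \/ p = - (rolling u v q phi).2.
  by apply: su2_so3_fibre => //; [exact: SU2_rolling|rewrite su2_so3_rolling].
- by left; exists phi => //; rewrite -ye pq.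
- by right; exists phi => //; rewrite -ye pq /rolling qmulqN.
Qed.

(** The Euclidean inner product of R^4. *)
Definition qdot p q : R := p.1 * q.1 + dot3 p.2 q.2.

(** On the inverse image, the direction y = cos phi u + sin phi v determines
    the quaternion up to sign, as a multiple of e^(2 phi w) q with w = u x v.
    This function is the inner product with e^(2 phi w) q, the double angle
    being expressed by the polynomials cos^2 - sin^2 and 2 cos sin in the
    coordinates of y; so its value is that sign. *)
Definition sheet u v q (z : vec3 R * quat R) : R :=
  (dot3 z.1 u ^+ 2 - dot3 z.1 v ^+ 2) * qdot z.2 q
  + 2 * dot3 z.1 u * dot3 z.1 v * qdot z.2 (qmul (imq (cross3 u v)) q).

Lemma sheet_rolling u v q phi : orthonormal2 u v -> SU2 q ->
  sheet u v q (rolling u v q phi) = 1.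
Proof.
move=> h q1; have [u1 v1 uv] := h; have w1 := S2_cross h.
have du : dot3 (rolling u v q phi).1 u = cos phi.
  transitivity (cos phi * dot3 u u + sin phi * dot3 u v); first by coord_ring.
  by rewrite u1 uv; ring.
have dv : dot3 (rolling u v q phi).1 v = sin phi.
  transitivity (cos phi * dot3 u v + sin phi * dot3 v v); first by coord_ring.
  by rewrite v1 uv; ring.
rewrite /sheet du dv -[RHS](SU2_rolling phi h q1).
have -> : cos phi ^+ 2 - sin phi ^+ 2 = cos (phi *+ 2).
  by rewrite cos_mulr2n -(cos2Dsin2 phi); ring.
have -> : 2 * cos phi * sin phi = sin (phi *+ 2) by rewrite sin_mulr2n; ring.
rewrite /rolling /qexp /=.
move: (cos (phi *+ 2)) (sin (phi *+ 2)) (cross3 u v) => c s w.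
by rewrite /qdot /qnorm2; coord_ring.
Qed.

Lemma sheet_rollingN u v q phi : orthonormal2 u v -> SU2 q ->
  sheet u v q (rolling u v (- q) phi) = -1.
Proof.
move=> h q1; rewrite -(sheet_rolling phi h q1).
by rewrite /rolling qmulqN /sheet /qdot /= !coordE /= ?coordE; ring.
Qed.

Lemma dot3_continuous (T : topologicalType) (f : T -> vec3 R) u :
  continuous f -> continuous (fun t => dot3 (f t) u).
Proof.
move=> cf; have -> : (fun t => dot3 (f t) u) =
    (fun t => f t 0 0 * u 0 0 + f t 1 0 * u 1 0 + f t 2 0 * u 2 0).
  by apply/funext => t; rewrite dot3E.
have ci i : continuous (fun t => f t i 0 * u i 0).
  move=> t; apply: cvgM; last exact: cvg_cst.
  apply: (@continuous_comp _ _ _ f (fun M : vec3 R => M i 0)); first exact: cf.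
  exact: coord_continuous.
by move=> t; apply: cvgD; [apply: cvgD|]; exact: ci.
Qed.

Lemma qdot_continuous (T : topologicalType) (f : T -> quat R) q :
  continuous f -> continuous (fun t => qdot (f t) q).
Proof.
move=> cf t; apply: cvgD.
  apply: cvgM; last exact: cvg_cst.
  by apply: (@continuous_comp _ _ _ f fst); [exact: cf|exact: cvg_fst].
apply: (@dot3_continuous _ (fun t => (f t).2)) => y.
by apply: (@continuous_comp _ _ _ f snd); [exact: cf|exact: cvg_snd].
Qed.

Lemma sheet_continuous u v q : continuous (sheet u v q).
Proof.
have c1 z : continuous (fun t : vec3 R * quat R => dot3 t.1 z).
  by apply: dot3_continuous => t; exact: cvg_fst.
have c2 z : continuous (fun t : vec3 R * quat R => qdot t.2 z).
  by apply: qdot_continuous => t; exact: cvg_snd.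
move=> t; apply: cvgD; apply: cvgM; try exact: c2.
  by apply: cvgB; apply: cvgM; exact: c1.
by apply: cvgM; [apply: cvgM|]; [exact: cvg_cst|exact: c1|exact: c1].
Qed.

Lemma rolling_continuous u v q : continuous (rolling u v q).
Proof.
have mulrnC n : continuous (fun t : R => t *+ n).
  exact: (@natmul_continuous R R).
have cosC n : continuous (fun t : R => cos (t *+ n)).
  move=> t; apply: (@continuous_comp _ _ _ (fun t : R => t *+ n) cos).
    exact: mulrnC.
  exact: continuous_cos.
have sinC n : continuous (fun t : R => sin (t *+ n)).
  move=> t; apply: (@continuous_comp _ _ _ (fun t : R => t *+ n) sin).
    exact: mulrnC.
  exact: continuous_sin.
(* Both components become trigonometric combinations of fixed vectors. *)
have -> : rolling u v q = fun t : R =>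
    (cos (t *+ 1) *: u + sin (t *+ 1) *: v,
     cos (t *+ 2) *: q + sin (t *+ 2) *: qmul (imq (cross3 u v)) q).
  by apply/funext => t; rewrite /rolling; congr pair; quat_ring.
have trigC (V : normedModType R) n (a b : V) :
    continuous (fun t : R => cos (t *+ n) *: a + sin (t *+ n) *: b).
  by move=> t; apply: cvgD; apply: cvgZr_tmp; [exact: cosC|exact: sinC].
move=> t.
exact: (cvg_pair (trigC (vec3 R) 1 u v t) (trigC (quat R) 2 _ _ t)).
Qed.

(** The curve is connected, so it lies in the component. Conversely a component
    meeting both curves would be mapped by [sheet] onto a set that contains
    1 and -1, hence 0, but no value other than these two is taken. *)
Lemma component_rolling u v q (z : vec3 R * quat R) :
  orthonormal2 u v -> SU2 q -> range (rolling u v q) z ->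
  connected_component (preimage_SU2 (range (rolling_SO3 u v (su2_so3 q)))) z
  = range (rolling u v q).
Proof.
move=> h q1 Lz; have Epre := preimage_rolling h q1.
apply/seteqP; split => [y Ay|]; last first.
  apply: connected_component_max => //; first by rewrite Epre; exact: subsetUl.
  apply: connected_continuous_connected; first exact/connected_intervalP.
  exact/continuous_subspaceT/rolling_continuous.
set A := connected_component _ _ in Ay.
have fA : is_interval (sheet u v q @` A).
  apply/connected_intervalP/connected_continuous_connected.
    exact: component_connected.
  exact/continuous_subspaceT/sheet_continuous.
have sAL : A `<=` range (rolling u v q) `|` range (rolling u v (- q)).
  by rewrite -Epre; exact: connected_component_sub.
have [//|[phi _ yE]] := sAL y Ay; exfalso.
have Az : A z by apply: connected_component_refl; rewrite Epre; left.
have f1 : (sheet u v q @` A) 1.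
  by exists z => //; case: Lz => t _ <-; exact: sheet_rolling.
have fN1 : (sheet u v q @` A) (-1).
  by exists y => //; rewrite -yE; exact: sheet_rollingN.
have [k Ak] : (sheet u v q @` A) 0.
  by apply: (fA _ _ fN1 f1); rewrite lerN10 ler01.
case: (sAL k Ak) => -[t _ <-].
  by rewrite sheet_rolling // => /eqP; rewrite oner_eq0.
by rewrite sheet_rollingN // => /eqP; rewrite oppr_eq0 oner_eq0.
Qed.

(** The base point of the component lies over a point of the line, so it
    supplies, rotated back to phi = 0, the quaternion q over g. *)
Lemma line_S2_SU2P (L : set (vec3 R * quat R)) :
  line_S2_SU2 3 L <->
  exists u v q, [/\ orthonormal2 u v, SU2 q & L = range (rolling u v q)].
Proof.
split=> [[L0 [z [[u [v [g [u1 v1 uv gSO EL0]]]] Lz ->]]]|]; last first.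
  move=> [u [v [q [h q1 ->]]]].
  exists (range (rolling_SO3 u v (su2_so3 q))), (rolling u v q 0); split.
  - have [u1 v1 uv] := h; exists u, v, (su2_so3 q); split => //.
    exact: su2_so3_SO3.
  - by rewrite preimage_rolling //; left; exists 0.
  - by rewrite component_rolling //; exists 0.
have h : orthonormal2 u v by [].
have w1 := S2_cross h.
have {}EL0 : L0 = range (rolling_SO3 u v g) by [].
move: Lz; rewrite {}EL0; case: z => y p [/= y1 p1 [phi _ [yE pE]]].
pose e := qexp (cross3 u v) (phi *+ 2).
have e1 : SU2 e by exact: SU2_qexp.
have e'1 := SU2_qconj e1.
pose q := qmul (qconj e) p.
have q1 : SU2 q by exact: SU2M.
have pq : p = qmul e q by rewrite /q qmulA qmul_qconj // qmul1q.
have gq : g = su2_so3 q.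
  rewrite su2_so3M // -pE (_ : (1 + 3) * phi = phi *+ 2 *+ 2); last by ring.
  by rewrite -su2_so3_qexp // mulmxA -su2_so3M // qconj_qmul // su2_so3_1 mul1mx.
exists u, v, q; split => //.
by rewrite gq component_rolling //; exists phi => //; rewrite -yE pq.
Qed.

End LiftedLines.

(** * Lines in the projectivized null cone are projectivized planes *)

Section ProjectiveLines.
Context {R : realType}.
Implicit Types (u v : vec3 R) (q : quat R) (x : octo R) (c s t phi : R).

(** A representative of the class that tau assigns to the pair of u and q. *)
Definition spoke u q : octo R := (imq u, qmul (imq u) q).

Definition nullplane u v q : {vspace octo R} :=
  <<[:: spoke u q; spoke v (- q)]>>%VS.

(** With [w = u x v] one has u w = - v and v w = u as quaternions; the rest is
    the double angle formula. *)
Lemma spoke_rolling u v q phi : orthonormal2 u v ->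
  spoke (rolling u v q phi).1 (rolling u v q phi).2 =
  cos phi *: spoke u q + sin phi *: spoke v (- q).
Proof.
move=> [u1 v1 uv].
set w := cross3 u v.
have uw : qmul (imq u) (imq w) = - imq v.
  transitivity (- dot3 u u *: imq v + dot3 u v *: imq u : quat R).
    by quat_ring.
  by rewrite u1 uv scaleN1r scale0r addr0.
have vw : qmul (imq v) (imq w) = imq u.
  transitivity (dot3 v v *: imq u - dot3 u v *: imq v : quat R).
    by quat_ring.
  by rewrite v1 uv scale1r scale0r subr0.
have imqD c s : imq (c *: u + s *: v) = c *: imq u + s *: imq v by quat_ring.
rewrite /spoke /rolling /= imqD; congr pair.
have -> : qexp w (phi *+ 2) = cos (phi *+ 2) *: (1, 0) + sin (phi *+ 2) *: imq w.
  by quat_ring.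
rewrite qmulA !(qmulDl, qmulDr, qmulZl, qmulZr) !qmulq1 uw vw.
have -> : cos (phi *+ 2) = cos phi ^+ 2 - sin phi ^+ 2.
  by rewrite cos_mulr2n -(cos2Dsin2 phi); ring.
rewrite sin_mulr2n qmulqN.
have := cos2Dsin2 phi; move: (cos phi) (sin phi) => c s cs.
(* Multiplied by c^2 + s^2, the right-hand side is cubic like the left one. *)
rewrite -[c in RHS]mulr1 -[s in RHS]mulr1 -cs.
by quat_ring.
Qed.

Lemma memv_span2 (x y z : octo R) :
  reflect (exists a c, z = a *: x + c *: y) (z \in <<[:: x; y]>>%VS).
Proof.
rewrite span_cons span_seq1; apply: (iffP memv_addP).
  by move=> [_ /vlineP[a ->] [_ /vlineP[c ->] ->]]; exists a, c.
move=> [a [c ->]]; exists (a *: x); rewrite ?memvZ ?memv_line //.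
by exists (c *: y); rewrite ?memvZ ?memv_line.
Qed.

Lemma pclassZ t x : t != 0 -> pclass (t *: x) = pclass x.
Proof.
move=> t0; apply/seteqP; split => y [k k0 ->].
  by exists (k * t); rewrite ?mulf_neq0 ?scalerA.
by exists (k / t); rewrite ?mulf_neq0 ?invr_neq0 // scalerA divfK.
Qed.

Lemma circle_angle c s : c ^+ 2 + s ^+ 2 = 1 ->
  exists phi, cos phi = c /\ sin phi = s.
Proof.
move=> cs.
have c1 : -1 <= c <= 1.
  by have s0 := sqr_ge0 s; apply/andP; split; nra.
have s2 : s ^+ 2 = 1 - c ^+ 2 by rewrite -cs; ring.
have [s0|s0] := leP 0 s; [exists (acos c)|exists (- acos c)];
  rewrite ?cosN ?sinN acosK ?in_itv //= sin_acos // -s2 sqrtr_sqr.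
  by rewrite ger0_norm.
by rewrite ltr0_norm // opprK.
Qed.

(** Up to a positive factor, a nonzero combination of two vectors has
    coefficients cos phi and sin phi. *)
Lemma tau_rolling u v q : orthonormal2 u v ->
  tau @` ((fun z => (pm z.1, z.2)) @` range (rolling u v q)) =
  projectivization (nullplane u v q).
Proof.
move=> h.
pose X phi := cos phi *: spoke u q + sin phi *: spoke v (- q).
have E phi : tau (pm (rolling u v q phi).1, (rolling u v q phi).2) =
    pclass (X phi).
  by rewrite tauE /X -spoke_rolling.
have X0 phi : X phi != 0.
  rewrite /X -spoke_rolling //; apply/eqP => -[z0 _ _].
  by have /S2_neq0/eqP := S2_rolling q phi h.
apply/seteqP; split=> [_ [_ [_ [phi _ <-] <-] <-]|_ [x [/memv_span2[a [c xE]] x0] <-]].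
  rewrite E; exists (X phi) => //.
  by split => //; apply/memv_span2; exists (cos phi), (sin phi).
pose rho := Num.sqrt (a ^+ 2 + c ^+ 2).
have rho2 : rho ^+ 2 = a ^+ 2 + c ^+ 2 by rewrite sqr_sqrtr // addr_ge0 ?sqr_ge0.
have rho0 : rho != 0.
  apply: contra x0 => /eqP r0; move: rho2; rewrite r0 expr0n /= => /esym/eqP.
  rewrite paddr_eq0 ?sqr_ge0 // !sqrf_eq0 xE => /andP[/eqP -> /eqP ->].
  by rewrite !scale0r addr0.
have [phi [cE sE]] : exists phi, cos phi = a / rho /\ sin phi = c / rho.
  by apply: circle_angle; rewrite !expr_div_n -mulrDl -rho2 divff // sqrf_eq0.
exists (pm (rolling u v q phi).1, (rolling u v q phi).2).
  by exists (rolling u v q phi) => //; exists phi.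
rewrite E /X cE sE xE -(pclassZ _ rho0); congr pclass.
by rewrite scalerDr !scalerA ![rho * _]mulrC !divfK.
Qed.

Lemma line_PCP (L : set (set (octo R))) :
  line_PC 3 L <->
  exists u v q,
    [/\ orthonormal2 u v, SU2 q & L = projectivization (nullplane u v q)].
Proof.
split=> [[_ [L0 /line_S2_SU2P[u [v [q [h q1 ->]]]] ->] ->]|].
  by exists u, v, q; split => //; exact: tau_rolling.
move=> [u [v [q [h q1 ->]]]]; rewrite -tau_rolling //; eexists; last by [].
by eexists; last by []; apply/line_S2_SU2P; exists u, v, q.
Qed.

End ProjectiveLines.

(** * The 2-dimensional null subalgebras *)

Section NullSubalgebras.
Context {R : realType}.
Implicit Types (u v : vec3 R) (p q b d : quat R) (x y z : octo R) (t : R).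
Implicit Types V : {vspace octo R}.

Lemma omulDl x y z : omul (x + y) z = omul x z + omul y z.
Proof.
by rewrite /omul /= !qconjD !(qmulDl, qmulDr); congr pair; rewrite addrACA.
Qed.

Lemma omulDr x y z : omul x (y + z) = omul x y + omul x z.
Proof. by rewrite /omul /= !(qmulDl, qmulDr); congr pair; rewrite addrACA. Qed.

Lemma omulZl t x y : omul (t *: x) y = t *: omul x y.
Proof. by rewrite /omul /= !qconjZ !(qmulZl, qmulZr) -!scalerDr. Qed.

Lemma omulZr t x y : omul x (t *: y) = t *: omul x y.
Proof. by rewrite /omul /= !(qmulZl, qmulZr) -!scalerDr. Qed.

Lemma omul_spoke u v p q : omul (spoke u p) (spoke v q) =
  (qmul (imq u) (imq v) - qmul (qmul (imq v) (qmul q (qconj p))) (imq u),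
   qmul (qmul (imq v) (imq u)) p - qmul (qmul (imq u) (imq v)) q).
Proof.
rewrite /omul /spoke /= qconjM !qconj_imq !(qmulqN, qmulNq) !qmulA; congr pair.
exact: addrC.
Qed.

Lemma spoke_sqr u q : SU2 q -> omul (spoke u q) (spoke u q) = 0.
Proof. by move=> q1; rewrite omul_spoke qmul_qconj // qmulq1 !subrr. Qed.

(** The sign of the second quaternion turns both components of the product into
    the anticommutator of u and v. *)
Lemma spoke_orth u v q : SU2 q -> dot3 u v = 0 ->
  omul (spoke u q) (spoke v (- q)) = 0.
Proof.
move=> q1 uv; rewrite omul_spoke !(qmulNq, qmulqN) qmul_qconj // qmulq1.
by rewrite !opprK -qmulDl [X in qmul X q]addrC imq_anticomm // qmul0q.
Qed.

Lemma null_nullplane u v q : SU2 q -> dot3 u v = 0 ->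
  null_subalgebra (nullplane u v q).
Proof.
move=> q1 uv x y /memv_span2[a [c ->]] /memv_span2[a' [c' ->]].
rewrite !(omulDl, omulDr, omulZl, omulZr) !spoke_sqr ?spoke_orth //; last first.
  exact: SU2N.
have -> : omul (spoke v (- q)) (spoke u q) = 0.
  rewrite -[q in spoke u q]opprK spoke_orth //; first exact: SU2N.
  by rewrite -uv; coord_ring.
by rewrite !(scaler0, addr0).
Qed.

Lemma dim_nullplane u v q : orthonormal2 u v -> \dim (nullplane u v q) = 2%N.
Proof.
move=> [u1 v1 uv].
suff: free [:: spoke u q; spoke v (- q)] by rewrite /free => /eqP.
rewrite free_cons span_seq1 seq1_free; apply/andP; split; last first.
  by apply/eqP => -[v0 _ _]; move/S2_neq0 : v1; rewrite v0 eqxx.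
apply/vlineP => -[k [_ ukv _ _]].
move: u1; rewrite /S2 /= {2}ukv (_ : dot3 u (k *: v) = k * dot3 u v).
  by rewrite uv mulr0 => /esym/eqP; rewrite oner_eq0.
by coord_ring.
Qed.

(** For x = ((a, u), b), the equation x x = 0 says a^2 - |u|^2 + |b|^2 = 0,
    2 a u = 0 and 2 a b = 0. If a were nonzero, then u = 0 and b = 0 by the last
    two, contradicting the first. *)
Lemma null_square x : omul x x = 0 ->
  x = (imq x.1.2, x.2) /\ dot3 x.1.2 x.1.2 = qnorm2 x.2.
Proof.
case: x => [[a u] b] /= xx.
have re : a ^+ 2 - dot3 u u + qnorm2 b = 0.
  have /(congr1 (fun z : octo R => z.1.1 : R)) := xx.
  by move=> /= <-; rewrite /qnorm2; coord_ring.
have im : (2 * a) *: u = 0.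
  have /(congr1 (fun z : octo R => z.1.2 : vec3 R)) := xx.
  by move=> /= <-; apply: vec3_eq; rewrite /= !coordE; ring.
have sn : (2 * a) *: b = 0.
  have /(congr1 (fun z : octo R => z.2 : quat R)) := xx.
  by move=> /= <-; quat_ring.
have a0 : a = 0.
  apply/eqP; apply: contraT => a0.
  have a20 : 2 * a != 0 by rewrite mulf_neq0 ?pnatr_eq0.
  move/eqP: im; rewrite scaler_eq0 (negPf a20) => /eqP u0.
  move/eqP: sn; rewrite scaler_eq0 (negPf a20) => /eqP b0.
  move: re; rewrite u0 b0 qnorm2E !coordE !mulr0 expr0n /= !addr0 subr0 => /eqP.
  by rewrite sqrf_eq0 (negPf a0).
split; first by rewrite a0.
by move: re; rewrite a0 expr0n /= sub0r addrC => /eqP; rewrite subr_eq0 => /eqP.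
Qed.

Lemma null_eq0 x : omul x x = 0 -> x.1.2 = 0 -> x = 0.
Proof.
move=> /null_square[xE xn] x0; suff b0 : x.2 = 0 by rewrite xE x0 b0.
move: xn; rewrite x0 => /esym.
have -> : dot3 (0 : vec3 R) 0 = 0 by coord_ring.
rewrite qnorm2E => /eqP; rewrite paddr_eq0 ?sqr_ge0 ?dot3_ge0 // sqrf_eq0.
by case: (x.2) => b v /= /andP[/eqP -> /eqP/dot3_eq0 ->].
Qed.

Lemma null_normalize x : omul x x = 0 -> x != 0 -> exists t, S2 (t *: x).1.2.
Proof.
move=> xx x0; have n0 : 0 < dot3 x.1.2 x.1.2.
  rewrite lt_def dot3_ge0 andbT; apply: contra x0 => /eqP/dot3_eq0 ?.
  by apply/eqP/null_eq0.
exists (Num.sqrt (dot3 x.1.2 x.1.2))^-1; rewrite /S2 /=; set k := _^-1.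
transitivity (k ^+ 2 * dot3 x.1.2 x.1.2); first by rewrite !coordE; ring.
by rewrite exprVn sqr_sqrtr ?ltW // mulVf // gt_eqF.
Qed.

(** As u^2 = -1, the first equation forces q = - u b. The first component of the
    product, u v + d conj(b) = 0, multiplied by b on the right, gives
    d = - u v b = v u b = - v q. *)
Lemma null_spokes u v b d : orthonormal2 u v -> SU2 b ->
  omul (imq u, b) (imq v, d) = 0 ->
  exists2 q, SU2 q & (imq u, b) = spoke u q /\ (imq v, d) = spoke v (- q).
Proof.
move=> [u1 v1 uv] b1 /(congr1 fst) /= ud.
have uvb : qmul (imq u) (qmul (imq v) b) = - d.
  apply/eqP; rewrite -addr_eq0 -{1}[d]qmulq1 -(qconj_qmul b1) !qmulA -qmulDl.
  by rewrite ud qmul0q.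
exists (- qmul (imq u) b); first by apply/SU2N/SU2M => //; exact: SU2_imq.
split; congr pair.
  rewrite qmulqN qmulA -qmulNq -qmulNq -qconj_imq qconj_qmul ?qmul1q //.
  exact: SU2_imq.
rewrite opprK qmulA; have /eqP := imq_anticomm uv.
by rewrite addrC addr_eq0 => /eqP ->; rewrite qmulNq -qmulA uvb opprK.
Qed.

(** Gram-Schmidt for the first components of a basis. *)
Lemma null_is_nullplane V : null_subalgebra V -> \dim V = 2%N ->
  exists u v q, [/\ orthonormal2 u v, SU2 q & V = nullplane u v q].
Proof.
move=> nV dV.
have x0V := memv_pick V; have x0n0 : vpick V != 0 by rewrite vpick0 -dimv_eq0 dV.
have [x xV Sx] : exists2 x, x \in V & S2 x.1.2.
  have [t0 Sx] := null_normalize (nV _ _ x0V x0V) x0n0.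
  by exists (t0 *: vpick V); rewrite ?memvZ.
have /subvPn[z zV zx] : ~~ (V <= <[x]>)%VS.
  by apply/negP => /dimvS; rewrite dV dim_vline; case: (x == 0).
pose z' := z - dot3 x.1.2 z.1.2 *: x.
have z'V : z' \in V by rewrite memvB ?memvZ.
have z'0 : z' != 0.
  by apply: contra zx; rewrite subr_eq0 => /eqP ->; rewrite memvZ ?memv_line.
have [t Sy] := null_normalize (nV z' z' z'V z'V) z'0.
pose y := t *: z'; have yV : y \in V by rewrite memvZ.
have xy : dot3 x.1.2 y.1.2 = 0.
  transitivity (t * (dot3 x.1.2 z.1.2 * (1 - dot3 x.1.2 x.1.2))).
    by rewrite /y /z' /= !coordE; ring.
  by rewrite Sx subrr !mulr0.
have [xE xn] := null_square (nV x x xV xV).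
have [yE _] := null_square (nV y y yV yV).
have h : orthonormal2 x.1.2 y.1.2 by [].
have [||q q1 [xs ys]] := null_spokes (b := x.2) (d := y.2) h.
- by rewrite /SU2 /= -xn.
- by rewrite -xE -yE; exact: nV.
exists x.1.2, y.1.2, q; split => //.
apply/eqP; rewrite eq_sym eqEdim dV dim_nullplane // leqnn andbT.
apply/span_subvP => k; rewrite !inE => /orP[] /eqP ->; first by rewrite -xs -xE.
by rewrite -ys -yE.
Qed.

End NullSubalgebras.

Theorem theorem5 (R : realType) (r : R) (hr : r = 3) :
  (forall L : set (set (octo R)), line_PC r L ->
     exists V : {vspace octo R},
       [/\ null_subalgebra V, \dim V = 2%N & L = projectivization V]) /\
  (forall V : {vspace octo R},
     null_subalgebra V -> \dim V = 2%N -> line_PC r (projectivization V)).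
Proof.
rewrite {}hr; split => [L /line_PCP[u [v [q [h q1 ->]]]]|V nV dV].
  exists (nullplane u v q); split=> //; last exact: dim_nullplane.
  by apply: null_nullplane => //; case: h.
have [u [v [q [h q1 ->]]]] := null_is_nullplane nV dV.
by apply/line_PCP; exists u, v, q.
Qed.
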